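(* Let $I\subseteq\mathsf{k}[x,y]$ be an anchored, non-principal monomial ideal such that $\mathsf{G}(I)=P^{\ast}(I)=\{g_1,\dots,g_{k+1}\}$, with the $g_i$ ordered in descending $y$-degree. Let $J\subseteq\mathsf{k}[x,y]$ be an anchored monomial ideal, and for $1\le i\le k$ let $v_i:=\operatorname{dist}_y(g_i,g_{i+1})$ and $u_i:=\operatorname{dist}_x(g_i,g_{i+1})$, and let $r$ be an integer with $$r\ge\left\lceil\max_{1\le i\le k}\left\{\frac{\operatorname{dist}_y(J)}{v_i}\right\}\right\rceil .$$ For $1\le i\le k$ let $\mathsf{A}_i,\mathsf{H}_i,\mathsf{B}_i$ be the $r$-segments of $(g_i,g_{i+1})J$, for $1\le i<k$ let $$\mathsf{C}_i:=\mathsf{B}_i\cdot y^{(r+1)v_{i+1}-\operatorname{dist}_y(\mathsf{B}_{i+1})}+\mathsf{A}_{i+1}\cdot x^{(r+1)u_i-\operatorname{dist}_x(\mathsf{A}_i)},$$ and let $\mathsf{C}_0:=\mathsf{A}_1$ and $\mathsf{C}_k:=\mathsf{B}_k$. Then, for all integers $\ell\ge0$, $$\sum_{i=1}^{k}(g_i,g_{i+1})^{r+1+\ell}J=\mathsf{C}_0\odot_y\mathsf{H}_1^{\odot_y\ell}\odot_y\mathsf{C}_1\odot_y\mathsf{H}_2^{\odot_y\ell}\odot_y\mathsf{C}_2\odot_y\cdots\odot_y\mathsf{H}_k^{\odot_y\ell}\odot_y\mathsf{C}_k .$$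
   Context: $\mathsf{k}$ is a field, $\mathbb{N}=\{1,2,\dots\}$. For a nonzero monomial ideal $I\subseteq\mathsf{k}[x,y]$: $\mathsf{G}(I)$ is its minimal set of monomial generators, $\gcd(I)$ is the greatest common divisor of all monomials in $I$, and $I$ is anchored if $I=I:\gcd(I)$. For $\bullet\in\{x,y\}$, $\operatorname{dist}_\bullet(I):=\max\{\deg_\bullet g\mid g\in\mathsf{G}(I:\gcd(I))\}$; for monomials $g,h$, $\operatorname{dist}_\bullet(g,h)$ is $\operatorname{dist}_\bullet$ of the ideal $(g,h)$. $P^{\ast}(I)$ is the set of weakly persistent generators of $I$, i.e. of those $f\in\mathsf{G}(I)$ with $f^n\in\mathsf{G}(I^n)$ for all $n\in\mathbb{N}$. Link: for monomial ideals $I,J$, $I\odot_y J:=(I:\gcd(I))\cdot y^{\operatorname{dist}_y(J)}+(J:\gcd(J))\cdot x^{\operatorname{dist}_x(I)}$. This operation is associative; $I^{\odot_y\ell}$ is the $\ell$-fold link of $I$ with itself, and factors with exponent $\ell=0$ are omitted. $r$-segments: let $u,v\in\mathbb{N}$, $J$ an anchored monomial ideal and $r\ge\lceil\operatorname{dist}_y(J)/v\rceil$ an integer. Put $Q:=(x^u,y^v)^{r+1}J$, $L=\{f\in\mathsf{G}(Q)\mid\deg_yf\ge rv\}$, $M=\{f\in\mathsf{G}(Q)\mid rv\le\deg_yf<(r+1)v\}$, $R=\{f\in\mathsf{G}(Q)\mid\deg_yf<rv\}$, and let $g=x^\alpha y^\beta$ be the element of $L$ of smallest $y$-degree. The $r$-segments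 (with respect to $y$) of $(x^u,y^v)J$ are $\mathsf{A}:=(L):y^\beta$, $\mathsf{H}:=(M\cup\{x^{\alpha-u}y^{\beta+v}\}):x^{\alpha-u}y^\beta$, $\mathsf{B}:=(R\cup\{g\}):x^\alpha$. For monomials $g,h$, the $r$-segments of $(g,h)J$ are those of $(x^u,y^v)J$ with $(x^u,y^v)=(g,h):\gcd(g,h)$. *)

(* Defs.v *)
From mathcomp Require Export all_boot all_order all_algebra.
From mathcomp Require Export boolp classical_sets.
From mathcomp Require Export mpoly.

Set Implicit Arguments.
Unset Strict Implicit.
Unset Printing Implicit Defensive.

Local Open Scope classical_set_scope.
Local Open Scope ring_scope.

(* The polynomial ring k[x, y] is {mpoly K[2]}.  A monomial is represented by
   its exponent vector m : 'X_{1..2}: 'X_[m] is the monomial itself, (_ + _)%MM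
   is multiplication and (_ <= _)%MM is divisibility. *)
Definition vx : 'I_2 := ord0.
Definition vy : 'I_2 := ord_max.

Definition mon (a b : nat) : 'X_{1..2} := (U_(vx) *+ a + U_(vy) *+ b)%MM.

(* Functions chosen with [xget d] return the unique element having the stated
   property; the default d is only reached for degenerate arguments, such as
   the zero ideal or an unbounded set. *)
Definition max_nat (A : set nat) : nat :=
  xget 0%N [set n | A n /\ forall m, A m -> (m <= n)%N].

Section Ideals.
Variable K : fieldType.
Local Notation R := {mpoly K[2]}.

Definition is_ideal (I : set R) : Prop :=
  I 0 /\ forall a p q : R, I p -> I q -> I (a * p + q).

Definition ideal_gen (A : set R) : set R := smallest is_ideal A.

Definition ideal_add (I J : set R) : set R := [set p + q | p in I & q in J].

Definition ideal_mul (I J : set R) : set R :=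
  ideal_gen [set p * q | p in I & q in J].

Definition ideal_exp (I : set R) (n : nat) : set R :=
  iter n (ideal_mul I) setT.

Definition principal (I : set R) : Prop := exists f : R, I = ideal_gen [set f].

Definition mideal (S : set 'X_{1..2}) : set R :=
  ideal_gen [set 'X_[m] | m in S].

Definition nonzero_monomial_ideal (I : set R) : Prop :=
  I <> [set 0] /\ exists S : set 'X_{1..2}, I = mideal S.

Definition colon (I : set R) (m : 'X_{1..2}) : set R :=
  [set p | I (p * 'X_[m])].

Definition mingens (I : set R) : set 'X_{1..2} :=
  xget set0 [set S | mideal S = I /\
                     forall T, T `<=` S -> mideal T = I -> T = S].

Definition mgcd (I : set R) : 'X_{1..2} :=
  let common_div (d : 'X_{1..2}) := forall m, I 'X_[m] -> (d <= m)%MM in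
  xget 0%MM [set d | common_div d /\
                     forall e, common_div e -> (e <= d)%MM].

Definition anchored (I : set R) : Prop := I = colon I (mgcd I).

Definition dist (c : 'I_2) (I : set R) : nat :=
  max_nat [set (m : 'X_{1..2}) c | m in mingens (colon I (mgcd I))].

Definition mdist (c : 'I_2) (g h : 'X_{1..2}) : nat :=
  dist c (mideal [set g; h]).

Definition weakly_persistent (I : set R) : set 'X_{1..2} :=
  [set f | mingens I f /\
           forall n : nat, (0 < n)%N -> mingens (ideal_exp I n) (f *+ n)%MM].

Definition link (I J : set R) : set R :=
  ideal_add
    (ideal_mul (colon I (mgcd I)) (mideal [set mon 0 (dist vy J)]))
    (ideal_mul (colon J (mgcd J)) (mideal [set mon (dist vx I) 0])).

(* The operation [link] is associative; iterated links are bracketed to the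
   left. *)
Definition link_seq (I0 : set R) (s : seq (set R)) : set R := foldl link I0 s.

Section Segments.
Variables (r u v : nat) (J : set R).

Definition segQ : set R :=
  ideal_mul (ideal_exp (mideal [set mon u 0; mon 0 v]) r.+1) J.

Definition segL : set 'X_{1..2} :=
  [set f | mingens segQ f /\ (r * v <= f vy)%N].

Definition segM : set 'X_{1..2} :=
  [set f | mingens segQ f /\ (r * v <= f vy < r.+1 * v)%N].

Definition segR : set 'X_{1..2} :=
  [set f | mingens segQ f /\ (f vy < r * v)%N].

Definition seg_min : 'X_{1..2} :=
  xget 0%MM [set f | segL f /\ forall f', segL f' -> (f vy <= f' vy)%N].

Let alpha : nat := seg_min vx.
Let beta : nat := seg_min vy.

Definition segA : set R := colon (mideal segL) (mon 0 beta).

Definition segH : set R :=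
  colon (mideal (segM `|` [set mon (alpha - u)%N (beta + v)%N]))
        (mon (alpha - u)%N beta).

Definition segB : set R :=
  colon (mideal (segR `|` [set seg_min])) (mon alpha 0).

End Segments.

(* The pair (u, v) with (x^u, y^v) = (g, h) : gcd(g, h) and u, v >= 1. *)
Definition anchored_exps (g h : 'X_{1..2}) : nat * nat :=
  let I := mideal [set g; h] in
  xget (0, 0)%N [set uv : nat * nat |
    [/\ (0 < uv.1)%N, (0 < uv.2)%N &
        mideal [set mon uv.1 0; mon 0 uv.2] = colon I (mgcd I)]].

Definition pairA (r : nat) (g h : 'X_{1..2}) (J : set R) : set R :=
  let uv := anchored_exps g h in segA r uv.1 uv.2 J.

Definition pairH (r : nat) (g h : 'X_{1..2}) (J : set R) : set R :=
  let uv := anchored_exps g h in segH r uv.1 uv.2 J.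

Definition pairB (r : nat) (g h : 'X_{1..2}) (J : set R) : set R :=
  let uv := anchored_exps g h in segB r uv.1 uv.2 J.

End Ideals.

Arguments mideal : clear implicits.
Arguments mdist : clear implicits.

(* Main.v *)
Require Import Defs.
From mathcomp Require Import all_boot all_order all_algebra.
From mathcomp Require Import boolp classical_sets.
From mathcomp Require Import mpoly zify.

Set Implicit Arguments.
Unset Strict Implicit.
Unset Printing Implicit Defensive.

Import Order.TTheory GRing.Theory Num.Theory.

(** The theorem becomes a statement about staircases. A monomial ideal is the
    same thing as the upset of its exponent vectors, and every operation that
    occurs (sum, product, power, colon, minimal generators, link) has a direct
    description on upsets. An anchored upset is bounded by a staircase that
    touches both axes, and linking two anchored ideals glues the end of the
    first staircase to the beginning of the second ([link_mono_ideal]). A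
    product of links is therefore the given ideal as soon as the staircase of
    that ideal can be cut, from top to bottom, into pieces that are translates
    of the staircases of the factors ([link_step]).

    Let F n be the staircase function of (x^u, y^v)^n J, so that F n b is the
    least x-exponent at height b. Two rules govern the passage from n to n + 1:
    below height (n + 1) v the staircase moves right by u ([stairS_low]), and
    above height dist_y(J) it moves up by v ([stairS_shift]). On the strip where
    both apply the staircase is periodic, one period going v up and u to the
    left. The point (alpha, beta) at which the segments are cut lies at the
    first step of the periodic strip, so A is the part of the staircase above
    beta, B the part below beta, and H one period. Raising the exponent from
    r + 1 to r + 1 + l leaves A and B unchanged up to translation and inserts l
    copies of H between them.

    In the sum of all (g_i, g_(i+1))^n J, at most two summands matter at any
    height. A summand with smaller index lives too high up. A summand with
    larger index lies to the right of the n-th power of the generator at its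
    upper end, and from dist_y(J) above that point on the preceding summand
    already reaches the same x-exponent ([chain_sum_window]). Going down, one
    meets the upper end of the first summand, which is C_0, then the periods
    H_1, then the zone in which the lower end of the first summand and the
    upper end of the second compete, which is C_1, and so on. [link_H] and
    [link_C] check that each factor is the corresponding piece. *)

Local Open Scope classical_set_scope.

(** * Exponent vectors and upsets of the plane *)

Lemma mon_x a b : mon a b vx = a.
Proof. by rewrite mnmDE !mulmnE !mnm1E /=; lia. Qed.

Lemma mon_y a b : mon a b vy = b.
Proof. by rewrite mnmDE !mulmnE !mnm1E /=; lia. Qed.

Lemma mnm2P (m m' : 'X_{1..2}) : m vx = m' vx -> m vy = m' vy -> m = m'.
Proof.
move=> hx hy; apply/mnmP=> i.
have [->//|->//] : i = vx \/ i = vy.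
by case: i => [[|[|n]] hi] //; [left|right]; apply: val_inj.
Qed.

Lemma mnm2_le (m m' : 'X_{1..2}) :
  (m <= m')%MM <-> (m vx <= m' vx) /\ (m vy <= m' vy).
Proof.
split=> [/mnm_lepP h|[hx hy]]; first by split; apply: h.
apply/mnm_lepP=> i.
have [->//|->//] : i = vx \/ i = vy.
by case: i => [[|[|n]] hi] //; [left|right]; apply: val_inj.
Qed.

Section Upsets.
Implicit Types U V W : nat -> nat -> Prop.

Definition upset U := forall a b a' b', a <= a' -> b <= b' -> U a b -> U a' b'.

Definition up (S : set 'X_{1..2}) a b := exists2 m, S m & m vx <= a /\ m vy <= b.

Definition minpts U : set 'X_{1..2} :=
  [set m | U (m vx) (m vy) /\
     forall a b, a <= m vx -> b <= m vy -> U a b -> a = m vx /\ b = m vy].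

Definition sumset U V a b :=
  exists a1 b1 a2 b2, [/\ U a1 b1, V a2 b2, a1 + a2 <= a & b1 + b2 <= b].

Lemma up_upset S : upset (up S).
Proof.
by move=> a b a' b' ha hb [m Sm [h1 h2]]; exists m => //; split; lia.
Qed.

Lemma sumset_upset U V : upset (sumset U V).
Proof.
move=> a b a' b' ha hb [a1 [b1 [a2 [b2 [h1 h2 h3 h4]]]]].
by exists a1, b1, a2, b2; split=> //; lia.
Qed.

(** Descent on the total degree: a point that is not minimal has another point of
    the upset below it of smaller degree. *)
Lemma minpts_below U a b : U a b ->
  exists2 m, minpts U m & m vx <= a /\ m vy <= b.
Proof.
elim: (a + b).+1 {-2}a {-2}b (ltnSn (a + b)) => // n IH {}a {}b hn Uab.
have [[a' [b' [ha hb Uab' hne]]]|hmin] :=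
  pselect (exists a' b', [/\ a' <= a, b' <= b, U a' b' & a' + b' < a + b]).
  have [m hm [h1 h2]] := IH a' b' (leq_trans hne hn) Uab'.
  by exists m => //; split; lia.
exists (mon a b); last by rewrite mon_x mon_y.
split; rewrite ?mon_x ?mon_y // => a' b' ha hb Uab'.
have : ~ (a' + b' < a + b) by move=> h; apply: hmin; exists a', b'.
by move=> h; split; lia.
Qed.

Lemma up_minpts U : upset U -> forall a b, up (minpts U) a b <-> U a b.
Proof.
move=> hU a b; split=> [[m [Um _] [h1 h2]]|]; last exact: minpts_below.
exact: hU h1 h2 Um.
Qed.

End Upsets.

(** * Monomial ideals as upsets *)

Section Ideals.
Variable K : fieldType.
Local Notation R := {mpoly K[2]}.
Implicit Types (U V W : nat -> nat -> Prop) (I J : set R) (S : set 'X_{1..2}).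
Local Open Scope ring_scope.

(** Sends an upset to the monomial ideal with these exponents. It is defined on
    supports, so that membership of a polynomial is read off monomial by monomial. *)
Definition mono_ideal U : set R := [set p | forall m, m \in msupp p -> U (m vx) (m vy)].

Lemma eq_mono_ideal U V : (forall a b, U a b <-> V a b) -> mono_ideal U = mono_ideal V.
Proof.
by move=> h; apply/seteqP; split=> p hp m /hp /h.
Qed.

Lemma mono_idealX U m : mono_ideal U 'X_[m] <-> U (m vx) (m vy).
Proof.
split=> [h|h m']; first by apply: h; rewrite msuppX mem_seq1.
by rewrite msuppX mem_seq1 => /eqP ->.
Qed.

Lemma mono_ideal_inj U V : mono_ideal U = mono_ideal V -> forall a b, U a b <-> V a b.
Proof.
move=> e a b; have := mono_idealX U (mon a b); have := mono_idealX V (mon a b).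
by rewrite e mon_x mon_y => h1 h2; split=> [/h2/h1|/h1/h2].
Qed.

Lemma mono_ideal_ideal U : upset U -> is_ideal (mono_ideal U).
Proof.
move=> hU; split=> [m|a p q hp hq m]; first by rewrite msupp0.
move/msuppD_le; rewrite mem_cat => /orP[|/hq//].
move=> /msuppM_le /allpairsP [[m1 m2] /= [_ h2 ->]].
by rewrite !mnmDE; apply: hU (hp _ h2); rewrite leq_addl.
Qed.

Lemma ideal_sum I (T : eqType) (s : seq T) (F : T -> R) :
  is_ideal I -> (forall i, i \in s -> I (F i)) -> I (\sum_(i <- s) F i).
Proof.
move=> [h0 hI]; elim: s => [|x s IH] h; first by rewrite big_nil.
rewrite big_cons -[F x]mul1r; apply: hI; first by apply: h; rewrite mem_head.
by apply: IH => i hi; apply: h; rewrite inE hi orbT.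
Qed.

Lemma ideal_mulr I a p : is_ideal I -> I p -> I (a * p).
Proof. by move=> [h0 hI] hp; rewrite -[a * p]addr0; apply: hI. Qed.

(** All inclusions of a monomial ideal into another ideal go through this lemma:
    only monomials have to be checked. *)
Lemma sub_mono_ideal U I : is_ideal I ->
  (forall m : 'X_{1..2}, U (m vx) (m vy) -> I 'X_[m]) -> mono_ideal U `<=` I.
Proof.
move=> hI h p hp; rewrite [p]mpolyE; apply: ideal_sum => // m hm.
by rewrite -mul_mpolyC; apply: ideal_mulr => //; apply: h; apply: hp.
Qed.

Lemma ideal_gen_ideal (A : set R) : is_ideal (ideal_gen A).
Proof.
split=> [I [[h0 _] _]//|a p q hp hq I [hI hA]].
by case: (hI) => _; apply; [apply: hp|apply: hq].
Qed.

Lemma sub_ideal_gen (A : set R) : A `<=` ideal_gen A.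
Proof. by move=> x Ax I [_]; apply. Qed.

Lemma ideal_gen_sub (A I : set R) : is_ideal I -> A `<=` I -> ideal_gen A `<=` I.
Proof. by move=> hI hA x; apply. Qed.

Lemma mideal_mono_ideal S : mideal K S = mono_ideal (up S).
Proof.
apply/seteqP; split.
  apply: ideal_gen_sub; first exact: mono_ideal_ideal (@up_upset S).
  by move=> _ [m Sm <-]; apply/mono_idealX; exists m.
apply: sub_mono_ideal; first exact: ideal_gen_ideal.
move=> m [m' Sm' [hx hy]].
have hle : (m' <= m)%MM by apply/mnm2_le.
rewrite -(submK hle) mpolyXD; apply: (@ideal_mulr (mideal K S)); first exact: ideal_gen_ideal.
by apply: sub_ideal_gen; exists m'.
Qed.

Lemma ideal_add_mono_ideal U V : upset U -> upset V ->
  ideal_add (mono_ideal U) (mono_ideal V) = mono_ideal (fun a b => U a b \/ V a b).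
Proof.
move=> hU hV; apply/seteqP; split.
  move=> _ [p hp [q hq <-]] m /msuppD_le; rewrite mem_cat.
  by case/orP=> [/hp|/hq]; [left|right].
apply: sub_mono_ideal.
  have [u0 uI] := mono_ideal_ideal hU; have [v0 vI] := mono_ideal_ideal hV.
  split; first by exists 0 => //; exists 0 => //; rewrite addr0.
  move=> a _ _ [p1 hp1 [q1 hq1 <-]] [p2 hp2 [q2 hq2 <-]].
  exists (a * p1 + p2); first exact: uI.
  by exists (a * q1 + q2); [exact: vI|rewrite mulrDr addrACA].
have z W : mono_ideal W 0 by move=> m; rewrite msupp0.
move=> m [h|h].
  by exists 'X_[m]; [apply/mono_idealX|exists 0 => //; rewrite addr0].
by exists 0 => //; exists 'X_[m]; [apply/mono_idealX|rewrite add0r].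
Qed.

Lemma ideal_mul_mono_ideal U V : upset U -> upset V ->
  ideal_mul (mono_ideal U) (mono_ideal V) = mono_ideal (sumset U V).
Proof.
move=> hU hV; apply/seteqP; split.
  apply: ideal_gen_sub; first exact: mono_ideal_ideal (@sumset_upset U V).
  move=> _ [p hp [q hq <-]] m /msuppM_le /allpairsP [[m1 m2] /= [h1 h2 ->]].
  rewrite !mnmDE; exists (m1 vx), (m1 vy), (m2 vx), (m2 vy).
  by split=> //; [apply: hp|apply: hq].
apply: sub_mono_ideal; first exact: ideal_gen_ideal.
move=> m [a1 [b1 [a2 [b2 [h1 h2 h3 h4]]]]]; apply: sub_ideal_gen.
have -> : m = (mon (m vx - a2) (m vy - b2) + mon a2 b2)%MM.
  by apply: mnm2P; rewrite mnmDE ?mon_x ?mon_y; lia.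
rewrite mpolyXD; exists 'X_[mon (m vx - a2) (m vy - b2)].
  by apply/mono_idealX; rewrite mon_x mon_y; apply: hU h1; lia.
by exists 'X_[mon a2 b2] => //; apply/mono_idealX; rewrite mon_x mon_y.
Qed.

Lemma setT_mono_ideal : [set: R] = mono_ideal (fun _ _ => True).
Proof. by apply/seteqP; split. Qed.

Lemma set0_mono_ideal : [set 0] = mono_ideal (fun _ _ => False).
Proof.
apply/seteqP; split=> [_ -> m|p hp]; first by rewrite msupp0.
apply/eqP; rewrite -msupp_eq0; case e: (msupp p) => [|m s] //.
by have := hp m; rewrite e mem_head => /(_ isT).
Qed.

Lemma colon_mono_ideal U m : upset U ->
  colon (mono_ideal U) m = mono_ideal (fun a b => U (a + m vx)%N (b + m vy)%N).
Proof.
move=> hU; apply/seteqP; split=> p hp m'.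
  move=> hm'; have := hp (m' + m)%MM; rewrite !mnmDE; apply.
  by rewrite (perm_mem (msuppMX p m)) addmC; apply: map_f.
rewrite (perm_mem (msuppMX p m)) => /mapP [m2 h2 ->].
by rewrite addmC !mnmDE; apply: hp.
Qed.

Lemma ideal_exp_pair m1 m2 n :
  ideal_exp (mideal K [set m1; m2]) n =
  mono_ideal (fun a b => exists i j, [/\ i + j = n,
     i * m1 vx + j * m2 vx <= a & i * m1 vy + j * m2 vy <= b])%N.
Proof.
elim: n => [|n IH].
  rewrite [LHS]setT_mono_ideal; apply: eq_mono_ideal => a b; split=> // _.
  by exists 0%N, 0%N.
rewrite /ideal_exp iterS -/(ideal_exp _ n) IH mideal_mono_ideal ideal_mul_mono_ideal.
- apply: eq_mono_ideal => a b; split.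
    move=> [a1 [b1 [a2 [b2 [[m [->|->] [h1 h2]] [i [j [e h3 h4]]] h5 h6]]]]].
      by exists i.+1, j; split; nia.
    by exists i, j.+1; split; nia.
  move=> [[|i] [j [e h1 h2]]].
    exists (m2 vx), (m2 vy), (n * m2 vx)%N, (n * m2 vy)%N; split; last 2 first.
    + by nia.
    + by nia.
    + by exists m2; [right|].
    + by exists 0%N, n; split; lia.
  exists (m1 vx), (m1 vy), (i * m1 vx + j * m2 vx)%N, (i * m1 vy + j * m2 vy)%N.
  split; last 2 first.
  + by nia.
  + by nia.
  + by exists m1; [left|].
  + by exists i, j; split; lia.
- exact: up_upset.
- by move=> a b a' b' ha hb [i [j [e h1 h2]]]; exists i, j; split; lia.
Qed.

Lemma big_ideal_add_mono_ideal (s : seq nat) (F : nat -> set R) (W : nat -> nat -> nat -> Prop) :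
  (forall i, upset (W i)) -> (forall i, i \in s -> F i = mono_ideal (W i)) ->
  \big[@ideal_add K/[set 0]]_(i <- s) F i =
  mono_ideal (fun a b => exists2 i, i \in s & W i a b).
Proof.
move=> hW; elim: s => [|x s IH] h.
  rewrite big_nil set0_mono_ideal; apply: eq_mono_ideal => a b.
  by split=> // -[i].
rewrite big_cons IH; last by move=> i hi; apply: h; rewrite inE hi orbT.
rewrite (h x) ?mem_head// ideal_add_mono_ideal //; last first.
  by move=> a b a' b' ha hb [i hi Wi]; exists i => //; apply: hW Wi.
apply: eq_mono_ideal => a b; split.
  case=> [Wx|[i hi Wi]]; first by exists x; rewrite ?mem_head.
  by exists i => //; rewrite inE hi orbT.
move=> [i]; rewrite inE => /orP[/eqP->|hi]; first by left.
by right; exists i.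
Qed.

(** A generating set of monomials contains every minimal point, because a minimal
    point has only itself below it, and the minimal points already generate. They
    are thus the unique irredundant generating set. *)
Lemma mingens_mono_ideal U : upset U -> mingens (mono_ideal U) = minpts U.
Proof.
move=> hU.
have upE T : mideal K T = mono_ideal U -> minpts U `<=` T.
  rewrite mideal_mono_ideal => eT; have e := mono_ideal_inj eT; move=> m [Um hm].
  have [m' Tm' [hx hy]] := (e _ _).2 Um.
  have Um' : U (m' vx) (m' vy) by apply/e; exists m'.
  by have [ex ey] := hm _ _ hx hy Um'; rewrite -(mnm2P ex ey).
have gen : mideal K (minpts U) = mono_ideal U.
  by rewrite mideal_mono_ideal; apply: eq_mono_ideal; apply: up_minpts.
apply: xget_unique; first split=> // T hT eT.
  by apply/seteqP; split=> //; apply: upE.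
by move=> T [eT hT]; rewrite (hT _ (upE _ eT) gen).
Qed.

Lemma mideal_minpts U : upset U -> mideal K (minpts U) = mono_ideal U.
Proof.
by move=> hU; rewrite mideal_mono_ideal; apply: eq_mono_ideal; apply: up_minpts.
Qed.

Lemma mgcd_mono_ideal U dx dy :
  (forall a b, U a b -> dx <= a /\ dy <= b)%N ->
  (exists b, U dx b) -> (exists a, U a dy) ->
  mgcd (mono_ideal U) = mon dx dy.
Proof.
move=> hd [b Ub] [a Ua].
have comm e : (forall m, mono_ideal U 'X_[m] -> (e <= m)%MM) <-> (e <= mon dx dy)%MM.
  split=> [h|/mnm2_le[]].
    apply/mnm2_le; rewrite mon_x mon_y; split.
      have /h /mnm2_le[] : mono_ideal U 'X_[mon dx b] by apply/mono_idealX; rewrite mon_x mon_y.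
      by rewrite mon_x.
    have /h /mnm2_le[_] : mono_ideal U 'X_[mon a dy] by apply/mono_idealX; rewrite mon_x mon_y.
    by rewrite mon_y.
  rewrite mon_x mon_y => h1 h2 m /mono_idealX /hd [h3 h4]; apply/mnm2_le.
  by split; lia.
apply: xget_unique; first by split=> [|e /comm//]; apply/comm/mnm2_le; split.
move=> m [/comm hm1 hm2].
have /hm2 : forall m, mono_ideal U 'X_[m] -> (mon dx dy <= m)%MM.
  by apply/comm/mnm2_le.
move: hm1 => /mnm2_le [h1 h2] /mnm2_le [h3 h4].
by apply: mnm2P; lia.
Qed.

(** * Anchored upsets and links *)

(** The staircase runs from [(0, dy)] to [(dx, 0)]: the ideal is anchored, with
    [dx] and [dy] its two distances. *)
Definition anchored_at U dx dy :=
  [/\ upset U, forall a, U a 0%N <-> (dx <= a)%N & forall b, U 0%N b <-> (dy <= b)%N].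

Lemma mgcd_anchored_at U dx dy : anchored_at U dx dy -> mgcd (mono_ideal U) = mon 0 0.
Proof.
move=> [hU hx hy]; apply: mgcd_mono_ideal => //.
  by exists dy; apply/hy.
by exists dx; apply/hx.
Qed.

Lemma colon_mgcd_anchored_at U dx dy : anchored_at U dx dy ->
  colon (mono_ideal U) (mgcd (mono_ideal U)) = mono_ideal U.
Proof.
move=> h; rewrite (mgcd_anchored_at h) colon_mono_ideal; last by case: h.
by apply: eq_mono_ideal => a b; rewrite mon_x mon_y !addn0.
Qed.

Lemma max_natE (A : set nat) n :
  A n -> (forall m, A m -> m <= n)%N -> max_nat A = n.
Proof.
move=> An hn; apply: xget_unique => // m [Am hm].
by apply/eqP; rewrite eqn_leq hn// hm.
Qed.

Lemma dist_x_mono_ideal I U dx dy : colon I (mgcd I) = mono_ideal U -> anchored_at U dx dy ->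
  dist vx I = dx.
Proof.
move=> e [hU hx hy]; rewrite /dist e mingens_mono_ideal //; apply: max_natE.
  exists (mon dx 0); last by rewrite mon_x.
  split; rewrite mon_x mon_y; first exact/hx.
  by move=> a b ha; rewrite leqn0 => /eqP -> /hx h; split=> //; lia.
move=> _ [m [Um hm] <-]; rewrite leqNgt; apply/negP => hlt.
have [] := hm dx 0%N (ltnW hlt) isT ((hx _).2 (leqnn _)).
by move: hlt; lia.
Qed.

Lemma dist_y_mono_ideal I U dx dy : colon I (mgcd I) = mono_ideal U -> anchored_at U dx dy ->
  dist vy I = dy.
Proof.
move=> e [hU hx hy]; rewrite /dist e mingens_mono_ideal //; apply: max_natE.
  exists (mon 0 dy); last by rewrite mon_y.
  split; rewrite mon_x mon_y; first exact/hy.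
  by move=> a b; rewrite leqn0 => /eqP -> hb /hy h; split=> //; lia.
move=> _ [m [Um hm] <-]; rewrite leqNgt; apply/negP => hlt.
have [] := hm 0%N dy isT (ltnW hlt) ((hy _).2 (leqnn _)).
by move: hlt; lia.
Qed.

Lemma dist_anchored_at_x U dx dy : anchored_at U dx dy -> dist vx (mono_ideal U) = dx.
Proof. by move=> h; apply: dist_x_mono_ideal (h); apply: colon_mgcd_anchored_at h. Qed.

Lemma dist_anchored_at_y U dx dy : anchored_at U dx dy -> dist vy (mono_ideal U) = dy.
Proof. by move=> h; apply: dist_y_mono_ideal (h); apply: colon_mgcd_anchored_at h. Qed.

Lemma mul_mon_mono_ideal U p q : upset U ->
  ideal_mul (mono_ideal U) (mideal K [set mon p q]) =
  mono_ideal (fun a b => [/\ p <= a, q <= b & U (a - p) (b - q)])%N.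
Proof.
move=> hU; rewrite mideal_mono_ideal ideal_mul_mono_ideal //; last exact: up_upset.
apply: eq_mono_ideal => a b; split.
  move=> [a1 [b1 [a2 [b2 [h1 [_ -> ] [h2 h3] h4 h5]]]]].
  move: h2 h3; rewrite mon_x mon_y => h2 h3.
  by split; [lia|lia|apply: hU h1; lia].
move=> [h1 h2 h3]; exists (a - p)%N, (b - q)%N, p, q; split=> //; try lia.
by exists (mon p q); rewrite ?mon_x ?mon_y.
Qed.

(** The staircase of the first ideal is raised to the height of the second one, and
    that of the second ideal is moved right to the end of the first. *)
Lemma link_mono_ideal U V dx dy ex ey : anchored_at U dx dy -> anchored_at V ex ey ->
  link (mono_ideal U) (mono_ideal V) =
  mono_ideal (fun a b => (ey <= b /\ U a (b - ey)) \/ (dx <= a /\ V (a - dx) b))%N.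
Proof.
move=> hU hV; have [uU _ _] := hU; have [uV _ _] := hV.
rewrite /link (colon_mgcd_anchored_at hU) (colon_mgcd_anchored_at hV).
rewrite (dist_anchored_at_x hU) (dist_anchored_at_y hV) !mul_mon_mono_ideal // ideal_add_mono_ideal.
- apply: eq_mono_ideal => a b; rewrite !subn0.
  by split=> -[[] *|[] *]; [left|right|left|right]; split.
- by move=> a b a' b' ha hb [h1 h2 h3]; split; [lia|lia|apply: uU h3; lia].
- by move=> a b a' b' ha hb [h1 h2 h3]; split; [lia|lia|apply: uV h3; lia].
Qed.

(** The inductive step of the proof. The partial link computed so far is the part of
    [W] above height [t]; its staircase ends on the horizontal axis at [x]. If the
    staircase of [V], moved right by [x], is the part of [W] between the heights
    [t'] and [t], then linking with [V] extends the partial link down to [t']. *)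
Lemma link_step W V t t' x top ex ey :
  upset W -> anchored_at V ex ey -> t = (t' + ey)%N ->
  (forall a, W a t <-> x <= a)%N -> (forall b, W 0%N (b + t)%N <-> top <= b)%N ->
  (forall a b, b <= ey -> V a b <-> W (a + x) (b + t'))%N ->
  link (mono_ideal (fun a b => W a (b + t)%N)) (mono_ideal V) =
  mono_ideal (fun a b => W a (b + t')%N).
Proof.
move=> hW hV et hx htop hblock; have [uV _ hVy] := hV.
rewrite (@link_mono_ideal _ _ x top ex ey) //; last first.
  by split=> // a b a' b' ha hb; apply: hW; lia.
apply: eq_mono_ideal => a b; case: (leqP ey b) => hb.
  have -> : (b - ey + t = b + t')%N by lia.
  split=> [[[]//|[hxa _]]|]; last by left.
  by apply: hW (leqnn a) _ ((hx a).2 hxa); lia.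
split=> [[[]//|[hxa /hblock]]|h]; first by rewrite subnK //; apply; lia.
have hxa : (x <= a)%N by apply/hx; apply: hW h => //; lia.
by right; split=> //; apply/hblock; [lia|rewrite subnK].
Qed.

End Ideals.

Arguments mono_ideal : clear implicits.

(** * Staircase functions *)

Definition least (P : nat -> Prop) : nat :=
  xget 0 [set n | P n /\ forall m, P m -> n <= m].

Lemma leastP (P : nat -> Prop) n : P n ->
  P (least P) /\ forall m, P m -> least P <= m.
Proof.
move=> Pn; apply: (@xgetPex _ 0 [set n | P n /\ forall m, P m -> n <= m]).
have ex : exists n, `[< P n >] by exists n; apply/asboolP.
case: (ex_minnP ex) => m /asboolP Pm hm.
by exists m; split=> // q /asboolP; apply: hm.
Qed.

Section Drops.
Variable F : nat -> nat.
Hypothesis F_noninc : forall b b', b <= b' -> F b' <= F b.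

(** The heights at which the staircase of [F] has a corner, i.e. at which the ideal
    has a minimal generator; height [0] always counts. *)
Definition drop b := forall c, c < b -> F b < F c.

Lemma drop_from_pred b : 0 < b -> F b < F b.-1 -> drop b.
Proof.
by move=> b0 h c hc; apply: leq_trans h _; apply: F_noninc; lia.
Qed.

Lemma drop_below b : exists2 c, c <= b & drop c /\ F c = F b.
Proof.
have [h1 h2] := @leastP (fun c => F c <= F b) b (leqnn _).
have hb := h2 _ (leqnn _).
exists (least (fun c => F c <= F b)) => //; split.
  move=> c hc; apply: leq_ltn_trans h1 _; rewrite ltnNge; apply/negP => /h2.
  by lia.
by apply/eqP; rewrite eqn_leq h1 F_noninc.
Qed.

Lemma minpts_stair m :
  minpts (fun a b => F b <= a) m <-> m vx = F (m vy) /\ drop (m vy).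
Proof.
split=> [[h hm]|[e h]].
  have [c hc [dc ec]] := drop_below (m vy).
  have [e1 e2] : F c = m vx /\ c = m vy by apply: hm => //; rewrite ec.
  by move: dc; rewrite -e1 -e2.
split; first by rewrite e.
move=> a b ha hb hF; have eb : b = m vy.
  apply/eqP; rewrite eqn_leq hb leqNgt; apply/negP => /h.
  by lia.
by split=> //; move: hF; rewrite eb; lia.
Qed.

End Drops.

(** * The staircase of a power of an irreducible ideal times an ideal *)

Section LocalStaircase.
Variables (Jp : nat -> nat -> Prop) (dx d u v : nat).
Hypothesis hJ : anchored_at Jp dx d.

(** The exponents of (x^u, y^v)^n J. *)
Definition powset n a b := exists i j a' b',
  [/\ i + j = n, Jp a' b', u * i + a' <= a & v * j + b' <= b].

Definition stair n b := least (fun a => powset n a b).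

Lemma stairP n a b : powset n a b <-> stair n b <= a.
Proof.
have [_ hx hy] := hJ.
have e : powset n (u * n + dx) b.
  by exists n, 0, dx, 0; split; [lia|apply/hx|lia|lia].
have [h1 h2] := @leastP (fun a => powset n a b) _ e.
split=> [|h]; first exact: h2.
by case: h1 => i [j [a' [b' [? ? ? ?]]]]; exists i, j, a', b'; split=> //; move: h; rewrite /stair; lia.
Qed.

Lemma stair_noninc n b b' : b <= b' -> stair n b' <= stair n b.
Proof.
move=> h; apply/stairP.
have /stairP [i [j [a' [c' [? ? ? ?]]]]] := leqnn (stair n b).
by exists i, j, a', c'; split=> //; lia.
Qed.

(** A generator below height (n + 1) v cannot take y^v in all its n + 1 factors, so one
    factor x^u can be removed. *)
Lemma stairS_low n b : b < n.+1 * v -> stair n.+1 b = stair n b + u.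
Proof.
move=> hb; apply/eqP; rewrite eqn_leq; apply/andP; split.
  apply/stairP; have /stairP [i [j [a' [c' [? ? ? ?]]]]] := leqnn (stair n b).
  by exists i.+1, j, a', c'; split=> //; nia.
have /stairP [[|i] [j [a' [c' [? ? ? ?]]]]] := leqnn (stair n.+1 b).
  by exfalso; nia.
have /stairP : powset n (stair n.+1 b - u) b.
  by exists i, j, a', c'; split=> //; nia.
by nia.
Qed.

Lemma stairS_shift_le n b : stair n.+1 (b + v) <= stair n b.
Proof.
apply/stairP; have /stairP [i [j [a' [c' [? ? ? ?]]]]] := leqnn (stair n b).
by exists i, j.+1, a', c'; split=> //; nia.
Qed.

(** A generator of the power n + 1 either involves no y^v at all, and then contains
    x^(u (n + 1)), or one factor y^v can be removed. *)
Lemma stairS_shift_ge n b : u * n.+1 <= stair n.+1 (b + v) \/ stair n b <= stair n.+1 (b + v).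
Proof.
have /stairP [i [[|j] [a' [c' [? ? ? ?]]]]] := leqnn (stair n.+1 (b + v)).
  by left; nia.
by right; apply/stairP; exists i, j, a', c'; split=> //; nia.
Qed.

Lemma stair_le n b : d <= b -> stair n b <= u * n.
Proof.
have [_ _ hy] := hJ; move=> /hy h.
by apply/stairP; exists n, 0, 0, b; split=> //; lia.
Qed.

(** From height [d] on, J contributes a pure power of y, hence the staircase is at
    most u n there and the first alternative of [stairS_shift_ge] is harmless. *)
Lemma stairS_shift n b : d <= b -> stair n.+1 (b + v) = stair n b.
Proof.
move=> hb; apply/eqP; rewrite eqn_leq stairS_shift_le /=.
by case: (stairS_shift_ge n b) (stair_le n hb) => //; nia.
Qed.

Lemma stair_add_low l n b : b < n.+1 * v -> stair (n + l) b = stair n b + u * l.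
Proof.
move=> hb; elim: l => [|l IH]; first by rewrite addn0 muln0 addn0.
by rewrite addnS stairS_low ?IH; nia.
Qed.

Lemma stair_add_shift l n b : d <= b -> stair (n + l) (b + l * v) = stair n b.
Proof.
move=> hb; elim: l => [|l IH]; first by rewrite !addn0.
by rewrite addnS mulSn [v + _]addnC addnA stairS_shift ?IH //; lia.
Qed.

(** On the strip where [stairS_low] and [stairS_shift] both hold, the staircase of a
    fixed power repeats itself. *)
Lemma stair_periodic n b : d <= b -> b < n * v -> stair n (b + v) + u = stair n b.
Proof.
move=> h1 h2; rewrite -(@stairS_shift n b) //.
by rewrite stairS_low; nia.
Qed.

Section Beta.
Hypothesis u0 : 0 < u.

Lemma stair0 n b : stair n b = 0 <-> n * v + d <= b.
Proof.
have [hU _ hy] := hJ; split=> [e|h].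
  have /stairP [[|i] [j [a' [c' [ej hJ' h1 h2]]]]] := leqnn (stair n b).
    have /hy : Jp 0 (b - v * n) by apply: hU hJ'; nia.
    by have := h2; nia.
  by move: h1; rewrite e; nia.
apply/eqP; rewrite -leqn0; apply/stairP.
by exists 0, n, 0, d; split=> //; [apply/hy|lia|nia].
Qed.

Hypothesis v0 : 0 < v.
Variable r : nat.
Hypothesis hr : d <= r * v.

Local Notation F := (stair r.+1).

(** The height of the first corner in the periodic strip; (alpha, beta) is the
    generator at which the three segments are cut. *)
Definition beta := least (fun b => r * v <= b /\ drop F b).

Definition alpha := F beta.

Let Fn : forall b b', b <= b' -> F b' <= F b.
Proof. by move=> *; apply: stair_noninc. Qed.

(** If there were no corner in this range, the staircase would be constant on a full
    period, whereas it must have moved left by u. *)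
Lemma beta_ex : exists2 b, b < r.+1 * v & r * v <= b /\ drop F b.
Proof.
have [c hc [dc ec]] := drop_below Fn (r.+1 * v).-1.
exists c; first by nia.
split=> //; rewrite leqNgt; apply/negP => hlt.
have h1 : F (r * v).-1 <= F c by apply: Fn; lia.
have := stairS_shift_le r.+1 (r * v).-1.
rewrite stairS_low; last by nia.
have -> : (r * v).-1 + v = (r.+1 * v).-1 by nia.
by lia.
Qed.

Lemma beta_spec : [/\ r * v <= beta, drop F beta, beta < r.+1 * v &
  forall c, r * v <= c -> drop F c -> beta <= c].
Proof.
have [b hb1 hb2] := beta_ex.
have [[h1 h2] h3] := @leastP (fun b => r * v <= b /\ drop F b) _ hb2.
split=> //; first exact: leq_ltn_trans (h3 _ hb2) hb1.
by move=> c *; apply: h3.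
Qed.

Lemma d_le_beta : d <= beta.
Proof. by case: beta_spec => h *; apply: leq_trans h. Qed.

Lemma alpha_bounds : u <= alpha <= u * r.+1.
Proof.
rewrite /alpha stair_le ?d_le_beta // andbT.
by rewrite stairS_low ?leq_addl //; case: beta_spec.
Qed.

(** If alpha takes its largest possible value, then the staircase cannot have dropped
    since height [d], where it is already at most that value. *)
Lemma alpha_max : alpha = u * r.+1 -> beta = d.
Proof.
move=> e; apply/eqP; rewrite eqn_leq d_le_beta andbT leqNgt; apply/negP => hlt.
have [_ hd _ _] := beta_spec.
have := hd d hlt; rewrite -/alpha e ltnNge stair_le //.
Qed.

(** The period that starts at the corner beta ends at a corner again: beta + v is the
    first height at which the staircase has moved left by u. *)
Lemma stair_beta_v b : (F (b + beta) <= alpha - u) <-> v <= b.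
Proof.
have [h1 h2 h3 h4] := beta_spec; have hd := d_le_beta.
have := stair_periodic hd h3; rewrite -/alpha => e; split.
  move=> h; rewrite leqNgt; apply/negP => hlt.
  have {}h : F (v.-1 + beta) <= alpha - u by apply: leq_trans h; apply: Fn; lia.
  have /andP [ha1 ha2] := alpha_bounds.
  case: (posnP beta) => [b0|b0].
    have := @stair_add_low r.+1 0 v.-1.
    rewrite add0n mul1n; move: h; rewrite b0 addn0.
    by move=> h /(_ (ltac:(lia))); nia.
  have h5 := h2 beta.-1 (ltac:(lia)).
  have := stairS_shift_ge r.+1 beta.-1; rewrite stairS_low; last by nia.
  have -> : beta.-1 + v = v.-1 + beta by lia.
  by rewrite -/alpha in h5; nia.
move=> h; rewrite addnC; have := @Fn (beta + v) (beta + b) (ltac:(lia)).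
by lia.
Qed.

(** By periodicity such a corner would repeat one between r v and beta. Hence all the
    corners of the period that starts at beta have height below (r + 1) v, which is
    the bound in the definition of the segment H. *)
Lemma no_drop c : r.+1 * v <= c -> c < beta + v -> ~ drop F c.
Proof.
move=> hc1 hc2 hd; have [h1 h2 h3 h4] := beta_spec.
have hv : drop F (c - v).
  case: (posnP (c - v)) => [->|hp]; first by move=> q.
  apply: (drop_from_pred Fn) => //.
  have e1 := @stair_periodic r.+1 (c - v); rewrite subnK in e1; last by nia.
  have e2 := stairS_shift_le r.+1 (c - v).-1; rewrite stairS_low in e2; last by nia.
  have e4 : (c - v).-1 + v = c.-1 by nia.
  have h5 := hd c.-1 (ltac:(lia)).
  rewrite e4 in e2; have := e1 (ltac:(nia)) (ltac:(nia)); lia.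
have := h4 (c - v) (ltac:(nia)) hv; lia.
Qed.

End Beta.
End LocalStaircase.

(** * The segments of one pair *)

Section Segments.
Variable K : fieldType.
Variables (Jp : nat -> nat -> Prop) (dx d u v r : nat).
Hypothesis hJ : anchored_at Jp dx d.
Hypotheses (u0 : 0 < u) (v0 : 0 < v) (hr : d <= r * v).

Local Notation J := (mono_ideal K Jp).
Local Notation F := (stair Jp u v r.+1).
Local Notation bet := (beta Jp u v r).
Local Notation alp := (alpha Jp u v r).

Let Fn : forall b b', b <= b' -> F b' <= F b.
Proof. by move=> *; apply: (stair_noninc _ _ hJ). Qed.

Lemma stair_upset n : upset (fun a b => stair Jp u v n b <= a).
Proof.
move=> a b a' b' ha hb h; apply: leq_trans ha; apply: leq_trans h.
by apply: (stair_noninc _ _ hJ).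
Qed.

Lemma segQE : segQ r u v J = mono_ideal K (fun a b => F b <= a).
Proof.
have [hU _ _] := hJ.
rewrite /segQ ideal_exp_pair ideal_mul_mono_ideal //; last first.
  by move=> a b a' b' ha hb [i [j [? ? ?]]]; exists i, j; split; lia.
apply: eq_mono_ideal => a b.
rewrite -(stairP _ _ hJ) ?mon_x ?mon_y; split.
  move=> [a1 [b1 [a2 [b2 [[i [j [? ? ?]]] ? ? ?]]]]].
  by exists i, j, a2, b2; split=> //; lia.
move=> [i [j [a2 [b2 [? ? ? ?]]]]].
by exists (u * i), (v * j), a2, b2; split=> //; exists i, j; split; lia.
Qed.

Lemma segQ_gens m : mingens (segQ r u v J) m <-> m vx = F (m vy) /\ drop F (m vy).
Proof.
rewrite segQE mingens_mono_ideal; last exact: stair_upset.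
exact: minpts_stair Fn m.
Qed.

Lemma seg_minE : seg_min r u v J = mon alp bet.
Proof.
have [h1 h2 h3 h4] := beta_spec hJ u0 v0 hr.
apply: xget_unique.
  split; first by split; [apply/segQ_gens|]; rewrite ?mon_x ?mon_y.
  by move=> f [/segQ_gens [_ hd] hf]; rewrite mon_y; apply: h4.
move=> f [[/segQ_gens [ex hd] hf] hm].
have e : f vy = bet.
  apply/eqP; rewrite eqn_leq h4 // andbT.
  have := hm (mon alp bet); rewrite mon_y; apply; split; rewrite ?mon_y //.
  by apply/segQ_gens; rewrite mon_x mon_y.
by apply: mnm2P; rewrite ?mon_x ?mon_y // ex e.
Qed.

(** Corners above height r v are corners above beta, so nothing is lost by the
    truncation. *)
Lemma segAE : segA r u v J = mono_ideal K (fun a b => F (b + bet) <= a).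
Proof.
have [h1 h2 h3 h4] := beta_spec hJ u0 v0 hr.
rewrite /segA seg_minE mon_y mideal_mono_ideal colon_mono_ideal; last exact: up_upset.
apply: eq_mono_ideal => a b; rewrite mon_x mon_y addn0; split.
  by move=> [m [/segQ_gens [ex _] _] [hx hy]]; apply: leq_trans hx; rewrite ex; apply: Fn.
move=> h; have [c hc [dc ec]] := drop_below Fn (b + bet).
have hbc : bet <= c.
  rewrite leqNgt; apply/negP => /h2; rewrite ec.
  by have := @Fn bet (b + bet) (leq_addl _ _); lia.
exists (mon (F c) c); last by rewrite mon_x mon_y; lia.
split; first by apply/segQ_gens; rewrite mon_x mon_y.
by rewrite mon_y; lia.
Qed.

(** Above beta the staircase of B is vertical because of the added generator; the
    corners below beta are those below r v. *)
Lemma segBE : segB r u v J = mono_ideal K (fun a b => F b <= a + alp).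
Proof.
have [h1 h2 h3 h4] := beta_spec hJ u0 v0 hr.
rewrite /segB seg_minE mon_x mideal_mono_ideal colon_mono_ideal; last exact: up_upset.
apply: eq_mono_ideal => a b; rewrite mon_x mon_y addn0; split.
  move=> [m [[/segQ_gens [ex _] _]|->]]; last first.
    by rewrite mon_x mon_y => -[_ /Fn]; rewrite -/alp; lia.
  by move=> [hx hy]; apply: leq_trans hx; rewrite ex; apply: Fn.
move=> h; case: (leqP bet b) => hb.
  by exists (mon alp bet); [right|rewrite mon_x mon_y; lia].
have [c hc [dc ec]] := drop_below Fn b.
exists (mon (F c) c); last by rewrite mon_x mon_y; lia.
left; split; first by apply/segQ_gens; rewrite mon_x mon_y.
by rewrite mon_y ltnNge; apply/negP => /h4 /(_ dc); lia.
Qed.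

(** The corners between beta and beta + v, together with the end point of the
    period, which is the extra generator in the definition of H. *)
Lemma segHE : segH r u v J = mono_ideal K (fun a b => F (b + bet) <= a + (alp - u)).
Proof.
have [h1 h2 h3 h4] := beta_spec hJ u0 v0 hr.
rewrite /segH seg_minE mon_x mon_y mideal_mono_ideal colon_mono_ideal; last exact: up_upset.
apply: eq_mono_ideal => a b; rewrite mon_x mon_y.
have hv := stair_beta_v hJ u0 v0 hr b; split.
  move=> [m [[/segQ_gens [ex _] _]|->]].
    by move=> [hx hy]; apply: leq_trans hx; rewrite ex; apply: Fn.
  by rewrite mon_x mon_y => -[_ hy]; have := hv.2 (ltac:(lia)); lia.
move=> h; case: (leqP v b) => hb.
  by exists (mon (alp - u) (bet + v)); [right|rewrite mon_x mon_y; lia].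
have [c hc [dc ec]] := drop_below Fn (b + bet).
have hbc : bet <= c.
  rewrite leqNgt; apply/negP => /h2; rewrite ec.
  by have := @Fn bet (b + bet) (leq_addl _ _); lia.
have hcv : c < r.+1 * v.
  rewrite ltnNge; apply/negP => hcr.
  by apply: (no_drop hJ u0 v0 hr hcr _ dc); lia.
exists (mon (F c) c); last by rewrite mon_x mon_y; lia.
left; split; first by apply/segQ_gens; rewrite mon_x mon_y.
by rewrite mon_y hcv andbT; lia.
Qed.

Lemma anchored_at_A : anchored_at (fun a b => F (b + bet) <= a) alp (r.+1 * v + d - bet).
Proof.
split=> [a b a' b' ha hb h|a|b].
- by apply: leq_trans ha; apply: leq_trans h; apply: Fn; lia.
- by [].
- rewrite leqn0; split=> [/eqP/(stair0 v hJ u0)|h]; first by lia.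
  by apply/eqP/(stair0 v hJ u0); lia.
Qed.

Lemma anchored_at_B : anchored_at (fun a b => F b <= a + alp) (F 0 - alp) bet.
Proof.
have [h1 h2 h3 h4] := beta_spec hJ u0 v0 hr.
split=> [a b a' b' ha hb h|a|b].
- by apply: leq_trans (Fn hb) _; lia.
- by lia.
- rewrite add0n; split=> [h|/Fn//].
  by rewrite leqNgt; apply/negP => /h2; rewrite -/alp; lia.
Qed.

Lemma anchored_at_H : anchored_at (fun a b => F (b + bet) <= a + (alp - u)) u v.
Proof.
split=> [a b a' b' ha hb h|a|b].
- have := @Fn (b + bet) (b' + bet); lia.
- have := alpha_bounds hJ u0 v0 hr; rewrite add0n -/alp; lia.
- by rewrite add0n; exact: (stair_beta_v hJ u0 v0 hr b).
Qed.

End Segments.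

(** * The sum along a chain of corners *)

Section Chain.
Variable K : fieldType.
Variables (Jp : nat -> nat -> Prop) (dx d r k l : nat) (X Y : nat -> nat).
Hypothesis hJ : anchored_at Jp dx d.

Local Notation u i := (X i.+1 - X i).
Local Notation v i := (Y i - Y i.+1).
Local Notation n := (r + 1 + l).
Local Notation F i := (stair Jp (u i) (v i)).
Local Notation bet i := (beta Jp (u i) (v i) r).
Local Notation alp i := (alpha Jp (u i) (v i) r).
Local Notation J := (mono_ideal K Jp).

(** The exponents of (g_i, g_(i+1))^n J, where g_i has exponents [(X i, Y i)]: the
    local staircase, moved by the n-th power of gcd(g_i, g_(i+1)). *)
Definition summand i a b := n * Y i.+1 <= b /\ n * X i + F i n (b - n * Y i.+1) <= a.

Definition chain_sum a b := exists2 i, i \in index_iota 1 k.+1 & summand i a b.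

Definition chainA i := segA r (u i) (v i) J.
Definition chainH i := segH r (u i) (v i) J.
Definition chainB i := segB r (u i) (v i) J.
Definition chainC i :=
  if i == k then chainB k else
  ideal_add
    (ideal_mul (chainB i) (mideal K [set mon 0 (r.+1 * v i.+1 - dist vy (chainB i.+1))]))
    (ideal_mul (chainA i.+1) (mideal K [set mon (r.+1 * u i - dist vx (chainA i)) 0])).

(** The height at which [m] periods of the i-th summand are still to come before its
    lower end begins. *)
Definition height i m := n * Y i.+1 + bet i + m * v i.

(** The height reached once C_i has been linked. *)
Definition bottom i := if i == k then 0 else height i.+1 l.

Lemma summand_upset i : upset (summand i).
Proof.
move=> a b a' b' ha hb [h1 h2]; split; first by lia.
have := @stair_noninc _ _ _ (u i) (v i) hJ n (b - n * Y i.+1) (b' - n * Y i.+1).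
by lia.
Qed.

Lemma chain_sum_upset : upset chain_sum.
Proof.
by move=> a b a' b' ha hb [i hi h]; exists i => //; apply: summand_upset h.
Qed.

(** The first m periods are removed by shifting up, the remaining l - m by moving
    right. *)
Lemma stair_middle i m c : d <= c -> c < r.+2 * v i -> m < l ->
  F i n (c + m * v i) = F i r.+1 c + u i * (l - m).
Proof.
move=> hc hc2 hm.
have -> : n = r.+1 + (l - m) + m by lia.
by rewrite (stair_add_shift _ _ hJ) // (stair_add_low _ hJ).
Qed.

Hypothesis hX : forall i, 1 <= i <= k -> X i < X i.+1.

Lemma u_gt0 i : 1 <= i <= k -> 0 < u i.
Proof. by move/hX; lia. Qed.

Lemma X_mono i j : 1 <= i -> i <= j -> j <= k.+1 -> X i <= X j.
Proof.
move=> hi; elim: j => [|j IH]; first by lia.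
rewrite leq_eqVlt => /orP[/eqP->//|hij] hj.
by apply: leq_trans (IH _ _) (ltnW (hX _)); lia.
Qed.

Hypothesis hY : forall i, 1 <= i <= k -> Y i.+1 < Y i.

Lemma v_gt0 i : 1 <= i <= k -> 0 < v i.
Proof. by move/hY; lia. Qed.

Lemma Y_mono i j : 1 <= i -> i <= j -> j <= k.+1 -> Y j <= Y i.
Proof.
move=> hi; elim: j => [|j IH]; first by lia.
rewrite leq_eqVlt => /orP[/eqP->//|hij] hj.
by apply: leq_trans (ltnW (hY _)) (IH _ _); lia.
Qed.

(** Summands before p start above the height b. Summands after q give x-exponents at
    least n X_(q+1), which the summand q already reaches with the pure power of
    g_(q+1), since J has a pure power of y of degree d. *)
Lemma chain_sum_window p q a b : 1 <= p -> p <= q -> q <= k ->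
  p = 1 \/ b < n * Y p -> q = k \/ n * Y q.+1 + d <= b ->
  chain_sum a b <-> exists2 i, p <= i <= q & summand i a b.
Proof.
move=> hp hpq hq hlow hhigh; split=> [[i]|[i hi h]]; last first.
  by exists i => //; rewrite mem_index_iota; lia.
rewrite mem_index_iota => hi [h1 h2].
case: (ltnP i p) => hip.
  case: hlow => hb; first by lia.
  have := @Y_mono i.+1 p isT hip; nia.
case: (leqP i q) => hiq; first by exists i; [lia|].
case: hhigh => hb; first by lia.
exists q; first by lia.
split; first by lia.
have hs := @stair_le _ _ _ (u q) (v q) hJ n (b - n * Y q.+1).
have hq1 := hX (i := q).
have := @X_mono q.+1 i isT hiq; nia.
Qed.

Lemma chain_sum_mid i a c : 1 <= i <= k -> d <= c < n * v i ->
  chain_sum a (n * Y i.+1 + c) <-> n * X i + F i n c <= a.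
Proof.
move=> hi hc; have hYi := hY hi.
rewrite (@chain_sum_window i i) //; try by nia.
rewrite /summand; split=> [[j hj]|h].
  have -> : j = i by lia.
  by rewrite addKn; case.
by exists i; [lia|rewrite addKn; split; [lia|]].
Qed.

Hypothesis hr : forall i, 1 <= i <= k -> d <= r * v i.

Lemma beta_lt i : 1 <= i <= k -> d <= bet i < r.+1 * v i.
Proof.
move=> hi; rewrite (d_le_beta hJ (u_gt0 hi) (v_gt0 hi) (hr hi)).
by case: (beta_spec hJ (u_gt0 hi) (v_gt0 hi) (hr hi)).
Qed.

Lemma stair_beta i m : 1 <= i <= k -> m <= l ->
  F i n (bet i + m * v i) = alp i + u i * (l - m).
Proof.
move=> hi hm; have hb := beta_lt hi.
have -> : n = r.+1 + (l - m) + m by lia.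
rewrite (stair_add_shift _ _ hJ); last by lia.
by rewrite (stair_add_low _ hJ) //; nia.
Qed.

Lemma chain_sum_height i m a : 1 <= i <= k -> m <= l ->
  chain_sum a (height i m) <-> n * X i + alp i + u i * (l - m) <= a.
Proof.
move=> hi hm; have hb := beta_lt hi; have v0 := v_gt0 hi.
rewrite /height -addnA chain_sum_mid //; last by nia.
by rewrite stair_beta // addnA.
Qed.

(** At the upper end the translate of A_(i+1) reaches the vertical axis only when
    t = 0, that is, when alpha is maximal; [alpha_max] then shows that its top is not
    lower than that of B_i. At the lower end B_i stays above the horizontal axis,
    because s is positive. *)
Lemma anchored_at_C i : 1 <= i < k ->
  let s := r.+1 * v i.+1 - bet i.+1 in
  let t := r.+1 * u i - alp i in
  anchored_at (fun a b => (s <= b /\ F i r.+1 (b - s) <= a + alp i) \/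
                   (t <= a /\ F i.+1 r.+1 (b + bet i.+1) <= a - t))
       (t + alp i.+1) (s + bet i).
Proof.
move=> hik s t.
have hi : 1 <= i <= k by lia.
have hi' : 1 <= i.+1 <= k by lia.
have hb := beta_lt hi; have hb' := beta_lt hi'.
have u0 := u_gt0 hi; have v0 := v_gt0 hi.
have u0' := u_gt0 hi'; have v0' := v_gt0 hi'.
have [uB _ hBy] := anchored_at_B hJ u0 v0 (hr hi).
have [uA hAx hAy] := anchored_at_A hJ u0' v0' (hr hi').
have hal := alpha_bounds hJ u0 v0 (hr hi).
have s0 : 0 < s by rewrite /s; lia.
split=> [a b a' b' ha hb1|a|b].
- case=> [[h1 h2]|[h1 h2]]; [left|right].
    by split; [lia|apply: uB h2; lia].
  by split; [lia|apply: uA h2; lia].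
- split=> [[[h _]|[h1 /hAx h2]]|h]; [lia|lia|right].
  by split; [lia|apply/hAx; lia].
- split=> [[[h1 /hBy h2]|[h1 h2]]|h].
  + by lia.
  + have t0 : alp i = u i * r.+1 by move: h1 hal; rewrite /t; lia.
    have -> := alpha_max hJ u0 v0 (hr hi) t0.
    by move: h2; rewrite sub0n => /hAy; rewrite /s; lia.
  by left; split; [lia|apply/hBy; lia].
Qed.

Lemma chainCE i : 1 <= i < k ->
  let s := r.+1 * v i.+1 - bet i.+1 in
  let t := r.+1 * u i - alp i in
  chainC i =
  mono_ideal K (fun a b => (s <= b /\ F i r.+1 (b - s) <= a + alp i) \/
                      (t <= a /\ F i.+1 r.+1 (b + bet i.+1) <= a - t)).
Proof.
move=> hik s t.
have hi : 1 <= i <= k by lia.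
have hi' : 1 <= i.+1 <= k by lia.
have u0 := u_gt0 hi; have v0 := v_gt0 hi.
have u0' := u_gt0 hi'; have v0' := v_gt0 hi'.
have LA := anchored_at_A hJ u0 v0 (hr hi).
have LA' := anchored_at_A hJ u0' v0' (hr hi').
have LB := anchored_at_B hJ u0 v0 (hr hi).
have LB' := anchored_at_B hJ u0' v0' (hr hi').
rewrite /chainC; have -> : (i == k) = false by lia.
rewrite /chainA /chainB !(segAE K hJ) ?(segBE K hJ) //; try exact: hr.
rewrite (dist_anchored_at_x K LA) (dist_anchored_at_y K LB').
have [uB _ _] := LB; have [uA _ _] := LA'.
rewrite !mul_mon_mono_ideal // ideal_add_mono_ideal.
- apply: eq_mono_ideal => a b; rewrite !subn0.
  by split=> -[[] *|[] *]; [left|right|left|right]; split.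
- by move=> a b a' b' ha hb [h1 h2 h3]; split; [lia|lia|apply: uB h3; lia].
- by move=> a b a' b' ha hb [h1 h2 h3]; split; [lia|lia|apply: uA h3; lia].
Qed.

Hypotheses (k0 : 0 < k) (X1 : X 1 = 0).

Lemma chain_sum_top b : chain_sum 0 b <-> n * Y 1 + d <= b.
Proof.
have hY1 := @hY 1 k0; have u1 := @u_gt0 1 k0.
have e : n * Y 1 = n * v 1 + n * Y 2 by nia.
split=> [[i]|h].
  rewrite mem_index_iota => hi [h1]; rewrite leqn0 addn_eq0 muln_eq0 => /andP[h2].
  have i1 : i = 1.
    case: (ltnP 1 i) => h; last by lia.
    have := hX (i := 1); have := @X_mono 2 i isT h; lia.
  by rewrite i1 in h1 *; move/eqP/(stair0 (v 1) hJ u1); lia.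
exists 1; first by rewrite mem_index_iota; lia.
split; first by lia.
(* only the first occurrence, since [X 1] also enters the step [u 1] *)
by rewrite {1}X1 muln0 add0n leqn0; apply/eqP/(stair0 (v 1) hJ u1); lia.
Qed.

(** [link_step] for the sum along the chain; the staircase of the sum starts on the
    vertical axis at n Y_1 + d. *)
Lemma link_chain V t t' x ex ey :
  anchored_at V ex ey -> t = t' + ey ->
  (forall a, chain_sum a t <-> x <= a) ->
  (forall a b, b <= ey -> V a b <-> chain_sum (a + x) (b + t')) ->
  link (mono_ideal K (fun a b => chain_sum a (b + t))) (mono_ideal K V) =
  mono_ideal K (fun a b => chain_sum a (b + t')).
Proof.
move=> hV et hx hb.
apply: (@link_step K _ _ _ _ x (n * Y 1 + d - t) _ _ chain_sum_upset hV) => // b.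
by rewrite chain_sum_top; lia.
Qed.

Lemma link_H i m : 1 <= i <= k -> m < l ->
  link (mono_ideal K (fun a b => chain_sum a (b + height i m.+1))) (chainH i) =
  mono_ideal K (fun a b => chain_sum a (b + height i m)).
Proof.
move=> hi hm; have hb := beta_lt hi; have v0 := v_gt0 hi; have u0 := u_gt0 hi.
rewrite /chainH (segHE K hJ u0 v0 (hr hi)).
apply: (link_chain (anchored_at_H hJ u0 v0 (hr hi))).
- by rewrite /height; lia.
- by move=> a; apply: chain_sum_height.
move=> a c hc.
have -> : c + height i m = n * Y i.+1 + (c + bet i + m * v i) by rewrite /height; lia.
rewrite chain_sum_mid //; last by nia.
rewrite stair_middle //; try by nia.
have := alpha_bounds hJ u0 v0 (hr hi).
have -> : u i * (l - m) = u i + u i * (l - m.+1) by nia.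
by lia.
Qed.

Lemma link_H_iter i m : 1 <= i <= k -> m <= l ->
  link_seq (mono_ideal K (fun a b => chain_sum a (b + height i m))) (nseq m (chainH i)) =
  mono_ideal K (fun a b => chain_sum a (b + height i 0)).
Proof.
move=> hi; elim: m => [//|m IH] hm.
by rewrite /link_seq /= link_H // -IH // ltnW.
Qed.

(** Above the periods of the first pair only the first summand is present. *)
Lemma chainA1E : chainA 1 = mono_ideal K (fun a b => chain_sum a (b + height 1 l)).
Proof.
have hb := beta_lt (i := 1) k0; have hY1 := @hY 1 k0.
rewrite /chainA (segAE K hJ (u_gt0 (i := 1) k0) (v_gt0 (i := 1) k0) (hr (i := 1) k0)).
apply: eq_mono_ideal => a b; rewrite /height.
rewrite (@chain_sum_window 1 1) //; [|by left|right; nia].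
have e : b + (n * Y 2 + bet 1 + l * v 1) - n * Y 2 = b + bet 1 + l * v 1.
  by move: (n * Y 2) (l * v 1); lia.
have nE : n = r.+1 + l by lia.
have e2 : F 1 n (b + bet 1 + l * v 1) = F 1 r.+1 (b + bet 1).
  by rewrite nE (stair_add_shift _ _ hJ) //; lia.
split=> [h|[j hj]].
  by exists 1 => //; split; [lia|rewrite e e2 {1}X1; lia].
have -> : j = 1 by lia.
by move=> [_]; rewrite e e2 {1}X1; lia.
Qed.

Hypothesis Yk : Y k.+1 = 0.

(** The factor C_i covers the heights from the lower end of summand i down to the
    corner of summand i + 1. Its two terms are the parts of these two summands that
    lie there, expressed relative to the left end alpha_i and to the height
    n Y_(i+2) + beta_(i+1) + l v_(i+1). Only the first term exists when i = k. *)
Lemma link_C i : 1 <= i <= k ->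
  link (mono_ideal K (fun a b => chain_sum a (b + height i 0))) (chainC i) =
  mono_ideal K (fun a b => chain_sum a (b + bottom i)).
Proof.
move=> hi; have hb := beta_lt hi; have v0 := v_gt0 hi; have u0 := u_gt0 hi.
have hup c : c <= bet i -> F i n c = F i r.+1 c + u i * l.
  move=> hc; have -> : n = r.+1 + l by lia.
  by rewrite (stair_add_low _ hJ); nia.
have hx a : chain_sum a (height i 0) <-> n * X i + alp i + u i * l <= a.
  by rewrite chain_sum_height // subn0.
have hal := alpha_bounds hJ u0 v0 (hr hi).
rewrite /bottom; case: eqP => [eik|/eqP nik].
  have -> : chainC i = chainB i by rewrite /chainC eik eqxx.
  rewrite /chainB (segBE K hJ u0 v0 (hr hi)).
  apply: (link_chain (anchored_at_B hJ u0 v0 (hr hi)) _ hx).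
    by rewrite /height eik Yk; lia.
  move=> a c hc; rewrite addn0 (@chain_sum_window i i) //; try by nia.
  have Yi1 : n * Y i.+1 = 0 by rewrite eik Yk muln0.
  have hYi := hY hi.
  split=> [h|[j hj]].
    exists i; first by lia.
    by split; rewrite Yi1 // subn0 hup //; lia.
  have -> : j = i by lia.
  by move=> [_]; rewrite Yi1 subn0 hup //; lia.
have hik : 1 <= i < k by lia.
have hi' : 1 <= i.+1 <= k by lia.
have hb' := beta_lt hi'; have v0' := v_gt0 hi'; have u0' := u_gt0 hi'.
rewrite (chainCE hik).
have hY1 := hY hi; have hY2 := hY hi'.
have hX1 := hX hi.
set s := r.+1 * v i.+1 - bet i.+1; set t := r.+1 * u i - alp i.
have ht : height i.+1 l + s = n * Y i.+1 by rewrite /height /s; nia.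
apply: (link_chain (anchored_at_C hik) _ hx); first by rewrite /height -/s; lia.
have i0 : 0 < i by lia.
move=> a c hc; rewrite -/s -/t.
rewrite (@chain_sum_window i i.+1) //; last 2 first.
- by right; nia.
- by right; rewrite /height; nia.
have e1 : s <= c -> c + height i.+1 l - n * Y i.+1 = c - s by lia.
have e2 : F i.+1 n (c + height i.+1 l - n * Y i.+2) = F i.+1 r.+1 (c + bet i.+1).
  have -> : c + height i.+1 l - n * Y i.+2 = c + bet i.+1 + l * v i.+1.
    by rewrite /height; lia.
  have -> : n = r.+1 + l by lia.
  by rewrite (stair_add_shift _ _ hJ) //; lia.
have e3 : n * X i.+1 = n * X i + r.+1 * u i + u i * l by nia.
split=> [[[h1 h2]|[h1 h2]]|[j hj]].
- exists i; first by lia.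
  split; first by lia.
  by rewrite e1 // hup; lia.
- exists i.+1; first by lia.
  split; first by rewrite /height; lia.
  by rewrite e2 e3; lia.
have [->|->] : j = i \/ j = i.+1 by lia.
  move=> [h1 h2]; left; have h3 : s <= c by lia.
  by split=> //; move: h2; rewrite e1 // hup; lia.
move=> [_]; rewrite e2 e3 => h; right; lia.
Qed.

Lemma link_seq_cat (I : set {mpoly K[2]}) s1 s2 :
  link_seq I (s1 ++ s2) = link_seq (link_seq I s1) s2.
Proof. exact: foldl_cat. Qed.

Lemma link_chain_prefix i : i <= k ->
  link_seq (chainA 1)
    (flatten [seq rcons (nseq l (chainH j)) (chainC j) | j <- iota 1 i]) =
  mono_ideal K (fun a b => chain_sum a (b + bottom i)).
Proof.
elim: i => [|i IH] hi.
  by rewrite /bottom; case: eqP => [|_]; [lia|rewrite chainA1E].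
have -> : iota 1 i.+1 = iota 1 i ++ [:: i.+1] by rewrite -{1}(addn1 i) iotaD add1n.
rewrite map_cat flatten_cat link_seq_cat IH; last by lia.
have hi1 : 1 <= i.+1 <= k by lia.
have -> : bottom i = height i.+1 l by rewrite /bottom; case: eqP => //; lia.
rewrite /= cats0 -cats1 link_seq_cat link_H_iter //.
by rewrite /link_seq /= link_C.
Qed.

Lemma link_chain_all :
  link_seq (chainA 1)
    (flatten [seq rcons (nseq l (chainH j)) (chainC j) | j <- iota 1 k]) =
  mono_ideal K chain_sum.
Proof.
rewrite link_chain_prefix //; apply: eq_mono_ideal => a b.
by rewrite /bottom eqxx addn0.
Qed.

End Chain.

Arguments chainA : clear implicits.
Arguments chainB : clear implicits.
Arguments chainC : clear implicits.
Arguments chainH : clear implicits.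

(** * From generators to corners *)

Section Input.
Variable K : fieldType.

Lemma monomial_mono_ideal (I : set {mpoly K[2]}) : nonzero_monomial_ideal I ->
  exists U, [/\ upset U, I = mono_ideal K U & exists a b, U a b].
Proof.
move=> [I0 [S eI]]; exists (up S); split; [exact: up_upset|by rewrite eI mideal_mono_ideal|].
apply: contrapT => hn; apply: I0; rewrite eI mideal_mono_ideal set0_mono_ideal.
apply: eq_mono_ideal => a b; split=> // h.
by apply: hn; exists a, b.
Qed.

(** Membership in an anchored ideal is invariant under division by its greatest
    common divisor x^p y^q. Dividing an element whose x-exponent is p, the least
    possible value, gives one with x-exponent 0, so p = 0. Likewise q = 0, and the
    ideal contains pure powers of x and y. *)
Lemma anchored_at_of_anchored U : upset U -> (exists a b, U a b) -> anchored (mono_ideal K U) ->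
  exists dx dy, anchored_at U dx dy.
Proof.
move=> hU [a0 [b0 h0]].
have [[b1 hb1] hx] := @leastP (fun a => exists b, U a b) a0 (ex_intro _ b0 h0).
have [[a1 ha1] hy] := @leastP (fun b => exists a, U a b) b0 (ex_intro _ a0 h0).
move: hb1 hx ha1 hy; set p := least _; set q := least _ => hb1 hx ha1 hy.
have bnd a b : U a b -> p <= a /\ q <= b.
  by move=> h; split; [apply: hx; exists b|apply: hy; exists a].
rewrite /anchored (mgcd_mono_ideal K bnd); [|by exists b1|by exists a1].
rewrite colon_mono_ideal // => e; have {e} := mono_ideal_inj e; rewrite mon_x mon_y => e.
have hpx : U 0 (b1 - q).
  by apply/e; rewrite subnK //; have [] := bnd _ _ hb1.
have hqy : U (a1 - p) 0.
  by apply/e; rewrite subnK //; have [] := bnd _ _ ha1.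
have [l1 l2] := @leastP (fun a => U a 0) _ hqy.
have [m1 m2] := @leastP (U 0) _ hpx.
exists (least (fun a => U a 0)), (least (U 0)); split=> // x.
  by split=> [|h]; [exact: l2|exact: hU h (leqnn _) l1].
by split=> [|h]; [exact: m2|exact: hU (leqnn _) h m1].
Qed.

Section Pair.
Variables g h : 'X_{1..2}.
Hypotheses (hx : g vx < h vx) (hy : h vy < g vy).

Local Notation u := (h vx - g vx).
Local Notation v := (g vy - h vy).

Lemma anchored_at_corner p q : 0 < p -> 0 < q -> anchored_at (fun a b => p <= a \/ q <= b) p q.
Proof. by move=> hp hq; split=> [a b a' b'|a|b]; lia. Qed.

Lemma colon_pair : colon (mideal K [set g; h]) (mgcd (mideal K [set g; h])) =
  mono_ideal K (fun a b => u <= a \/ v <= b).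
Proof.
have upE a b : up [set g; h] a b <-> (g vx <= a /\ g vy <= b) \/ (h vx <= a /\ h vy <= b).
  split=> [[m [->|->]]|[|]]; [by left|by right| |].
    by exists g; [left|].
  by exists h; [right|].
rewrite mideal_mono_ideal (@mgcd_mono_ideal K _ (g vx) (h vy)).
- rewrite colon_mono_ideal; last exact: up_upset.
  by apply: eq_mono_ideal => a b; rewrite upE mon_x mon_y; lia.
- by move=> a b /upE; lia.
- by exists (g vy); apply/upE; lia.
- by exists (h vx); apply/upE; lia.
Qed.

Lemma mdist_x_pair : mdist K vx g h = u.
Proof. by apply: dist_x_mono_ideal colon_pair (anchored_at_corner _ _); lia. Qed.

Lemma mdist_y_pair : mdist K vy g h = v.
Proof. by apply: dist_y_mono_ideal colon_pair (anchored_at_corner _ _); lia. Qed.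

Lemma anchored_exps_pair : anchored_exps K g h = (u, v).
Proof.
have corner p q : mideal K [set mon p 0; mon 0 q] =
    mono_ideal K (fun a b => p <= a \/ q <= b).
  rewrite mideal_mono_ideal; apply: eq_mono_ideal => a b; split.
    by move=> [m [->|->]]; rewrite mon_x mon_y => -[? ?]; [left|right].
  case=> ?; first by exists (mon p 0); [left|rewrite mon_x mon_y].
  by exists (mon 0 q); [right|rewrite mon_x mon_y].
apply: xget_unique => /=.
  by split; [lia|lia|rewrite colon_pair corner].
move=> [p q] /= [hp hq]; rewrite colon_pair corner => e; have m := mono_ideal_inj e.
have [_ ax ay] := anchored_at_corner hp hq.
have [_ bx bY] := @anchored_at_corner u v (ltac:(lia)) (ltac:(lia)).
have e1 : p = u.
  have := (m p 0).1 ((ax p).2 (leqnn p)).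
  have := (m u 0).2 ((bx u).2 (leqnn u)).
  lia.
have e2 : q = v.
  have := (m 0 q).1 ((ay q).2 (leqnn q)).
  have := (m 0 v).2 ((bY v).2 (leqnn v)).
  lia.
by rewrite e1 e2.
Qed.

End Pair.

(** A product of p factors g_(i+1) and q factors g_i, with p + q = n, is the n-th power
    of the greatest common divisor of the two times x^(u p) y^(v q). *)
Lemma pair_pow_mul (Jp : nat -> nat -> Prop) dx d (g : nat -> 'X_{1..2}) i r l :
  anchored_at Jp dx d -> g i vx < g i.+1 vx -> g i.+1 vy < g i vy ->
  ideal_mul (ideal_exp (mideal K [set g i; g i.+1]) (r + 1 + l)) (mono_ideal K Jp) =
  mono_ideal K (summand Jp r l (fun i => g i vx) (fun i => g i vy) i).
Proof.
move=> hJ hx hy; have [hU _ _] := hJ.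
rewrite ideal_exp_pair ideal_mul_mono_ideal //; last first.
  by move=> a b a' b' ha hb [i1 [j [? ? ?]]]; exists i1, j; split; lia.
apply: eq_mono_ideal => a b; rewrite /summand; set n := r + 1 + l.
have st := stairP (g i.+1 vx - g i vx) (g i vy - g i.+1 vy) hJ n.
split.
  move=> [a1 [b1 [a2 [b2 [[j [i1 [e1 h1 h2]] h3 h4 h5]]]]]].
  split; first by nia.
  have /st : powset Jp (g i.+1 vx - g i vx) (g i vy - g i.+1 vy) n
     (a - n * g i vx) (b - n * g i.+1 vy).
    by exists i1, j, a2, b2; split=> //; [lia|nia|nia].
  by nia.
move=> [h1 h2].
have /st [i1 [j [a2 [b2 [e h3 h4 h5]]]]] :
  stair Jp (g i.+1 vx - g i vx) (g i vy - g i.+1 vy) n (b - n * g i.+1 vy)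
    <= a - n * g i vx by lia.
exists (a - a2), (b - b2), a2, b2; split=> //; [|nia|nia].
exists j, i1; split; [lia|nia|nia].
Qed.

End Input.

Local Open Scope ring_scope.

Theorem theorem4p16 (K : fieldType) (I J : set {mpoly K[2]})
    (k : nat) (g : nat -> 'X_{1..2}) (r : nat)
    (hI : nonzero_monomial_ideal I) (hIanch : anchored I)
    (hInp : ~ principal I)
    (hGP : mingens I = weakly_persistent I)
    (hG : mingens I = [set g i | i in [set i | (1 <= i <= k.+1)%N]])
    (hgdesc : forall i j : nat,
       (1 <= i)%N -> (i < j)%N -> (j <= k.+1)%N -> (g j vy < g i vy)%N)
    (hJ : nonzero_monomial_ideal J) (hJanch : anchored J) :
  let v := fun i : nat => mdist K vy (g i) (g i.+1) in
  let u := fun i : nat => mdist K vx (g i) (g i.+1) in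
  Num.ceil (\big[Num.max/0]_(1 <= i < k.+1) ((dist vy J)%:R / (v i)%:R : rat))
    <= r%:Z ->
  let A := fun i : nat => pairA r (g i) (g i.+1) J in
  let H := fun i : nat => pairH r (g i) (g i.+1) J in
  let B := fun i : nat => pairB r (g i) (g i.+1) J in
  let C := fun i : nat =>
    if i == 0%N then A 1%N
    else if i == k then B k
    else ideal_add
      (ideal_mul (B i)
         (mideal K [set mon 0 (r.+1 * v i.+1 - dist vy (B i.+1))%N]))
      (ideal_mul (A i.+1)
         (mideal K [set mon (r.+1 * u i - dist vx (A i))%N 0])) in
  forall l : nat,
    \big[@ideal_add K/[set 0]]_(1 <= i < k.+1)
       ideal_mul (ideal_exp (mideal K [set g i; g i.+1]) (r + 1 + l)%N) J
    = link_seq (C 0%N)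
        (flatten [seq rcons (nseq l (H i)) (C i) | i <- iota 1 k]).
Proof.
move=> v u hr A H B C l.
have [UI [uI eI nI]] := monomial_mono_ideal hI.
have [UJ [uJ eJ nJ]] := monomial_mono_ideal hJ.
have [ax [ay hlI]] : exists dx dy, anchored_at UI dx dy.
  by apply: (@anchored_at_of_anchored K) => //; rewrite -eI.
have [dx [d hlJ]] : exists dx dy, anchored_at UJ dx dy.
  by apply: (@anchored_at_of_anchored K) => //; rewrite -eJ.
have gmin i : (1 <= i <= k.+1)%N -> minpts UI (g i).
  by move=> hi; rewrite -(mingens_mono_ideal K uI) -eI hG; exists i.
have ming m : minpts UI m -> exists2 i, (1 <= i <= k.+1)%N & g i = m.
  by rewrite -(mingens_mono_ideal K uI) -eI hG.
have [_ hIx hIy] := hlI.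
(* An anchored ideal contains pure powers of x and y; by minimality they are
   the last and the first generator. *)
have Yk : g k.+1 vy = 0%N.
  have [m mm [_]] := minpts_below ((hIx ax).2 (leqnn ax)).
  have [i hi <-] := ming _ mm; rewrite leqn0 => /eqP e.
  have [h|h|<-//] := ltngtP i k.+1; last by lia.
  by have := @hgdesc i k.+1 (ltac:(lia)) h (leqnn _); lia.
have X1 : g 1%N vx = 0%N.
  have [m mm [hm _]] := minpts_below ((hIy ay).2 (leqnn ay)).
  have [i hi e] := ming _ mm; rewrite -e leqn0 in hm; move/eqP: hm => hm.
  have [h|h|h] := ltngtP 1%N i; [|by lia|by move: hm; rewrite -h].
  have hy := @hgdesc 1%N i isT h (ltac:(lia)).
  have [_ hmin] := gmin 1%N isT.
  have [_ ey] := hmin (g i vx) (g i vy) (ltac:(lia)) (ltac:(lia)) (gmin i hi).1.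
  by lia.
(* A single generator would make the ideal principal. *)
have k0 : (0 < k)%N.
  rewrite lt0n; apply/negP => /eqP k0; apply: hInp; exists 'X_[g 1%N].
  have e : minpts UI = [set g 1%N].
    apply/seteqP; split=> [m /ming [i hi <-]|_ ->]; last exact: gmin.
    by have -> : i = 1%N by lia.
  by rewrite eI -(mideal_minpts K uI) e /mideal image_set1.
have hY i : (1 <= i <= k)%N -> (g i.+1 vy < g i vy)%N.
  by move=> hi; apply: hgdesc; lia.
(* Distinct minimal generators are incomparable. *)
have hX i : (1 <= i <= k)%N -> (g i vx < g i.+1 vx)%N.
  move=> hi; rewrite ltnNge; apply/negP => hle.
  have [_ hmin] := gmin i (ltac:(lia)).
  have := hY i hi.
  have [_ ey] := hmin (g i.+1 vx) (g i.+1 vy) hle (ltnW (hY i hi))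
    (gmin i.+1 (ltac:(lia))).1.
  by lia.
have vE i : (1 <= i <= k)%N -> v i = (g i vy - g i.+1 vy)%N.
  by move=> hi; apply: mdist_y_pair; [apply: hX|apply: hY].
have uE i : (1 <= i <= k)%N -> u i = (g i.+1 vx - g i vx)%N.
  by move=> hi; apply: mdist_x_pair; [apply: hX|apply: hY].
have {}hr i : (1 <= i <= k)%N -> (d <= r * (g i vy - g i.+1 vy))%N.
  move=> hi; have v0 := hY i hi.
  move: hr; rewrite ceil_le_int eJ (dist_anchored_at_y K hlJ) => hr.
  have : (d%:R / (v i)%:R : rat) <= r%:R.
    apply: le_trans hr.
    apply: (@le_bigmax_seq _ _ _ (index_iota 1 k.+1) 0 i xpredT
      (fun i => d%:R / (v i)%:R : rat)) => //.
    by rewrite mem_index_iota.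
  by rewrite vE // ler_pdivrMr ?ltr0n ?subn_gt0 // -natrM ler_nat.
have AE i : (1 <= i <= k)%N ->
    A i = chainA K UJ r (fun i => g i vx) (fun i => g i vy) i.
  by move=> hi; rewrite /A /pairA anchored_exps_pair ?hX ?hY // eJ.
have BE i : (1 <= i <= k)%N ->
    B i = chainB K UJ r (fun i => g i vx) (fun i => g i vy) i.
  by move=> hi; rewrite /B /pairB anchored_exps_pair ?hX ?hY // eJ.
have HE i : (1 <= i <= k)%N ->
    H i = chainH K UJ r (fun i => g i vx) (fun i => g i vy) i.
  by move=> hi; rewrite /H /pairH anchored_exps_pair ?hX ?hY // eJ.
have CE i : (1 <= i <= k)%N ->
    C i = chainC K UJ r k (fun i => g i vx) (fun i => g i vy) i.
  move=> hi; rewrite /C /chainC; have -> : (i == 0%N) = false by lia.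
  case: eqP => [<-|/eqP hik]; first exact: BE.
  by rewrite !AE ?BE ?uE ?vE //; lia.
have -> : [seq rcons (nseq l (H i)) (C i) | i <- iota 1 k] =
    [seq rcons (nseq l (chainH K UJ r (fun i => g i vx) (fun i => g i vy) i))
      (chainC K UJ r k (fun i => g i vx) (fun i => g i vy) i) | i <- iota 1 k].
  apply/eq_in_map => i; rewrite mem_iota => hi.
  by rewrite HE ?CE //; lia.
have -> : C 0%N = chainA K UJ r (fun i => g i vx) (fun i => g i vy) 1.
  by rewrite /C eqxx AE.
rewrite (link_chain_all K l hlJ hX hY hr k0 X1 Yk).
apply: (@big_ideal_add_mono_ideal K _ _ (summand UJ r l (fun i => g i vx) (fun i => g i vy))).
  by move=> i; apply: (summand_upset hlJ).
move=> i; rewrite mem_index_iota => hi.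
by rewrite eJ (pair_pow_mul K _ _ hlJ (hX i hi) (hY i hi)).
Qed.
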